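(* Under the standing assumptions (A1) and (A2) of the context, suppose that $\min_{X\in\mathcal{D}}\Phi_k(X)$ has a global minimizer $X^*$ of rank at most $p$. Let $\epsilon_g,\epsilon_H\ge 0$ and let $R\in\mathcal{M}$ satisfy $\|\operatorname{grad}\Psi_k(R)\|_F\le\epsilon_g$ and $S(R^TR)\succeq-\epsilon_H I$. Then $$\Psi_k(R)-\min_{R'\in\mathcal{M}}\Psi_k(R')\le\sqrt{\operatorname{diam}(\mathcal{D})}\,\frac{\epsilon_g}{2}+\operatorname{diam}(\mathcal{D})\,\epsilon_H,$$ where $\operatorname{diam}(\mathcal{D})=\max_{X\in\mathcal{D}}\operatorname{tr}(X)$. Moreover, if $I_n\in\operatorname{span}(\{B_i\}_{i=1}^{m_0})$, where $I_n$ is the $n\times n$ identity, then the bound can be refined to $$\Psi_k(R)-\min_{R'\in\mathcal{M}}\Psi_k(R')\le\operatorname{diam}(\mathcal{D})\,\epsilon_H.$$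
   Context: $\mathbb{S}^n$ is the space of real symmetric $n\times n$ matrices, $\langle A,B\rangle=\operatorname{tr}(A^TB)$, $\|\cdot\|_F$ is the Frobenius norm. Given are $A_1,\dots,A_m,B_1,\dots,B_{m_0}\in\mathbb{S}^n$, $b\in\mathbb{R}^m$, $b_0\in\mathbb{R}^{m_0}$; $\mathcal{A}(X)=(\operatorname{tr}(A_iX))_{i=1}^m$, $\mathcal{B}(Y)=(\operatorname{tr}(B_iY))_{i=1}^{m_0}$ (for any $Y\in\mathbb{R}^{n\times n}$), $\mathcal{B}^*(v)=\sum_i v_iB_i$. Set $\mathcal{D}=\{X\in\mathbb{S}^n: X\succeq 0,\ \mathcal{B}(X)=b_0\}$ and, for a fixed positive integer $p$, $\mathcal{M}=\{R\in\mathbb{R}^{p\times n}:\mathcal{B}(R^TR)=b_0\}$. The underlying problem is $\min_{X\in\mathcal{D}} f(X)+h(X)$ subject to $\mathcal{A}(X)=b$. Standing assumptions. (A1) This problem has a low-rank optimal solution (no specific rank bound is prescribed) and its objective is bounded from below; $f:\mathbb{S}^n\to\mathbb{R}$ is convex and twice differentiable with Lipschitz continuous gradient; $h:\mathbb{S}^n\to\mathbb{R}\cup\{+\infty\}$ is convex, lower semicontinuous and proper. (A2) For every $X\in\mathcal{D}$ the matrices $B_1X,\dots,B_{m_0}X$ are linearly independent, and $\mathcal{M}$ is a compact embedded submanifold of $\mathbb{R}^{p\times n}$. Subproblem. Fix $y^k\in\mathbb{R}^m$, $Z^k\in\mathbb{S}^n$, $\sigma_k>0$. Let $h^*$ be the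 convex conjugate of $h$, $\operatorname{prox}_g(W)=\operatorname{argmin}_{V\in\mathbb{S}^n} g(V)+\frac12\|V-W\|_F^2$, and $T(X)=\sigma_k^{-1}\operatorname{prox}_{\sigma_kh^*}(\sigma_kX-Z^k)$. Then $$\Phi_k(X)=f(X)+h\big(X-Z^k/\sigma_k-T(X)\big)+\tfrac{\sigma_k}{2}\big(\|\mathcal{A}(X)-b-y^k/\sigma_k\|_2^2+\|T(X)\|_F^2\big),\qquad \Psi_k(R)=\Phi_k(R^TR).$$ $\Phi_k$ is continuously differentiable. For $X\in\mathcal{D}$, $u(X)\in\mathbb{R}^{m_0}$ is the unique solution $u$ of $\mathcal{B}\big(X(\nabla\Phi_k(X)-\mathcal{B}^*(u))\big)=0$, and $S(X)=\nabla\Phi_k(X)-\mathcal{B}^*(u(X))$. $\operatorname{grad}\Psi_k(R)$ is the Riemannian gradient: the orthogonal projection of $\nabla\Psi_k(R)$ onto $T_R\mathcal{M}=\{U\in\mathbb{R}^{p\times n}:\mathcal{B}(R^TU+U^TR)=0\}$. *)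

(* Defs.v *)
From HB Require Import structures.
From mathcomp Require Import all_boot all_order all_algebra.
From mathcomp Require Import all_classical all_reals all_analysis.

Set Implicit Arguments.
Unset Strict Implicit.
Unset Printing Implicit Defensive.

Import Order.TTheory GRing.Theory Num.Theory.
Import numFieldNormedType.Exports.

Local Open Scope classical_set_scope.
Local Open Scope ring_scope.

(* The Euclidean space of real symmetric n x n matrices, as a normed module of
   its own, so that continuity and differentiability of functions on it are the
   library's.  It carries the restriction of the library's (entrywise maximum)
   norm on matrices; the Frobenius norm is [frob_norm] below. *)
Section SymmetricMatrices.
Context {K : realType} {n : nat}.

Record symmx : Type := SymMx {
  symmx_val :> 'M[K]_n ;
  symmx_valP : symmx_val \is symmetricmx }.

HB.instance Definition _ := [isSub for symmx_val].
HB.instance Definition _ := [Choice of symmx by <:].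

Lemma symmetricmxP (A : 'M[K]_n) : reflect (A^T = A) (A \is symmetricmx).
Proof.
rewrite qualifE /= expr0 scale1r map_mx_id; last by [].
by rewrite eq_sym; exact: eqP.
Qed.

Fact symmx_submod_closed :
  submod_closed [pred A : 'M[K]_n | A \is symmetricmx].
Proof.
split=> [|a A B]; rewrite !inE.
  by apply/symmetricmxP; rewrite trmx0.
move=> /symmetricmxP sA /symmetricmxP sB; apply/symmetricmxP.
by rewrite linearD linearZ /= sA sB.
Qed.

HB.instance Definition _ :=
  GRing.SubChoice_isSubLmodule.Build K 'M[K]_n _ symmx symmx_submod_closed.

Definition symmx_norm (X : symmx) : K := `|symmx_val X|.

Fact symmx_normD X Y : symmx_norm (X + Y) <= symmx_norm X + symmx_norm Y.
Proof. exact: ler_normD. Qed.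

Fact symmx_normZ a X : symmx_norm (a *: X) = `|a| * symmx_norm X.
Proof. exact: normrZ. Qed.

Fact symmx_norm0_eq0 X : symmx_norm X = 0 -> X = 0.
Proof. by move=> /normr0_eq0 X0; apply: val_inj. Qed.

HB.instance Definition _ :=
  Lmodule_isNormed.Build K symmx symmx_normD symmx_normZ symmx_norm0_eq0.

Fact gram_subproof p (R : 'M[K]_(p, n)) : R^T *m R \is symmetricmx.
Proof. by apply/symmetricmxP; rewrite trmx_mul trmxK. Qed.

Definition gram p (R : 'M[K]_(p, n)) : symmx := SymMx (gram_subproof R).

End SymmetricMatrices.
Arguments symmx : clear implicits.


Section MatrixGeometry.
Context {K : realType}.

Definition inner m n (A B : 'M[K]_(m, n)) : K := \tr (A^T *m B).

Definition frob_norm m n (A : 'M[K]_(m, n)) : K := Num.sqrt (inner A A).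

(* Used on symmetric matrices only. *)
Definition psd n (X : 'M[K]_n) : Prop :=
  forall v : 'cV[K]_n, 0 <= (v^T *m X *m v) 0 0.

Definition is_min (S : set K) (v : K) : Prop := S v /\ lbound S v.
Definition is_max (S : set K) (v : K) : Prop := S v /\ ubound S v.

(* Y |-> (tr (C_i Y))_i, for an arbitrary square matrix Y. *)
Definition trace_op n k (C : 'I_k -> symmx K n) (Y : 'M[K]_n) : 'rV[K]_k :=
  \row_i \tr (C i *m Y).

Definition trace_op_adj n k (C : 'I_k -> symmx K n) (v : 'rV[K]_k) :
    symmx K n :=
  \sum_i v 0 i *: C i.

(* The representative of the Frechet derivative 'd f x with respect to [ip]
   (meaningful where f is differentiable). *)
Definition gradient (V : normedModType K) (ip : V -> V -> K) (f : V -> K)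
    (x : V) : V :=
  xget 0 [set g | forall v, 'd f x v = ip g v].

Definition gradS n (f : symmx K n -> K) : symmx K n -> symmx K n :=
  gradient (fun X Y : symmx K n => inner X Y) f.

Definition gradM p n (f : 'M[K]_(p, n) -> K) : 'M[K]_(p, n) -> 'M[K]_(p, n) :=
  gradient (@inner p n) f.

Definition is_proj m n (T : set 'M[K]_(m, n)) (G U : 'M[K]_(m, n)) : Prop :=
  T U /\ forall W, T W -> inner (G - U) W = 0.

End MatrixGeometry.

Section Submanifolds.
Context {K : realType}.

(* F is C^k on the open set U of a finite-dimensional space: its iterated
   directional derivatives of order < k are differentiable on U and those of
   order k are continuous on U. *)
Fixpoint Ck_on (k : nat) (V W : normedModType K) (U : set V) (F : V -> W) :
    Prop :=
  match k with
  | 0%N => forall x, U x -> {for x, continuous F}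
  | k'.+1 => (forall x, U x -> differentiable F x) /\
             (forall v : V, Ck_on k' U (fun x => 'd F x v))
  end.

Definition smooth_on (V W : normedModType K) (U : set V) (F : V -> W) : Prop :=
  forall k, Ck_on k U F.

(* Near each of its points, M is the zero set of a smooth map to R^d whose
   differential at that point is onto; the codimension d is uniform. *)
Definition embedded_submanifold (V : normedModType K) (M : set V) : Prop :=
  exists d : nat, forall x, M x ->
    exists (U : set V) (F : V -> 'rV[K]_d),
      [/\ open U /\ U x,
          smooth_on U F,
          forall y, U y -> (M y <-> F y = 0)
        & forall w : 'rV[K]_d, exists v : V, 'd F x v = w].

End Submanifolds.

Section ConvexAnalysis.
Context {K : realType} {n : nat}.
Implicit Types (h g : symmx K n -> \bar K).
Local Open Scope ereal_scope.

Definition econvex h : Prop :=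
  forall (X Y : symmx K n) (t : K), (0 <= t <= 1)%R ->
    h (t *: X + (1 - t) *: Y)%R <= t%:E * h X + (1 - t)%:E * h Y.

Definition eproper h : Prop :=
  (forall X, h X != -oo) /\ (exists X, h X < +oo).

Definition conjugate h (Y : symmx K n) : \bar K :=
  ereal_sup (range (fun X : symmx K n => (inner Y X)%:E - h X)).

Definition prox_obj g (W V : symmx K n) : \bar K :=
  g V + (2^-1 * frob_norm (V - W) ^+ 2)%:E.

Definition prox g (W : symmx K n) : symmx K n :=
  xget 0%R [set V | forall V', prox_obj g W V <= prox_obj g W V'].

End ConvexAnalysis.

Section Problem.
Context {K : realType} {n m m0 : nat}.
Variables (B : 'I_m0 -> symmx K n) (b0 : 'rV[K]_m0).

Definition Dset : set (symmx K n) :=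
  [set X : symmx K n | psd X /\ trace_op B X = b0].

Definition Mset (p : nat) : set 'M[K]_(p, n) :=
  [set R | trace_op B (R^T *m R) = b0].

Definition tangent p (R : 'M[K]_(p, n)) : set 'M[K]_(p, n) :=
  [set U | trace_op B (R^T *m U + U^T *m R) = 0].

Variables (f : symmx K n -> K) (h : symmx K n -> \bar K).
Variables (A : 'I_m -> symmx K n) (b : 'rV[K]_m).

Definition objective (X : symmx K n) : \bar K := ((f X)%:E + h X)%E.

Definition feasible : set (symmx K n) :=
  [set X : symmx K n | Dset X /\ trace_op A X = b].

Definition optimal (X : symmx K n) : Prop :=
  feasible X /\ forall X', feasible X' -> (objective X <= objective X')%E.

Variables (y : 'rV[K]_m) (Z : symmx K n) (sigma : K).

Definition Tk (X : symmx K n) : symmx K n :=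
  sigma^-1 *: prox (fun V => sigma%:E * conjugate h V)%E (sigma *: X - Z).

(* By Moreau's identity X - Z / sigma - T(X) is the proximal point of h / sigma
   at X - Z / sigma; so h is finite there and [fine] loses nothing. *)
Definition Phi (X : symmx K n) : K :=
  f X + fine (h (X - sigma^-1 *: Z - Tk X))
  + sigma / 2 * (frob_norm (trace_op A X - b - sigma^-1 *: y) ^+ 2
                 + frob_norm (Tk X) ^+ 2).

Definition Psi p (R : 'M[K]_(p, n)) : K := Phi (gram R).

Definition uk (X : symmx K n) : 'rV[K]_m0 :=
  xget 0 [set u | trace_op B (X *m (gradS Phi X - trace_op_adj B u)) = 0].

Definition Sk (X : symmx K n) : symmx K n :=
  gradS Phi X - trace_op_adj B (uk X).

Definition rgradPsi p (R : 'M[K]_(p, n)) : 'M[K]_(p, n) :=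
  xget 0 [set U | is_proj (tangent R) (gradM (@Psi p) R) U].

End Problem.
Arguments Mset {K n m0} B b0 p _.

(* Main.v *)
(* Put w = X - Z / sigma and let P be the proximal map of h / sigma.  By Moreau's
   identity Phi is the sum of f, the Moreau envelope of h / sigma at w and a
   convex quadratic, so Phi is convex and differentiable and lies above its
   tangents.  Write X = R^T R and S = S(X): the equation B(X S) = 0 defining u(X)
   makes 2 R S the Riemannian gradient of Psi at R.  As X and the minimizer Xs
   share the value b0 of B,
     Phi(X) - Phi(Xs) <= <grad Phi(X), X - Xs> = <S, X> - <S, Xs>.
   The first term is <2 R S, R> / 2 <= eps_g |R|_F / 2 with |R|_F^2 = tr X, and it
   vanishes when I is in the span of the B_i.  The second is at most
   eps_H tr Xs by the curvature hypothesis.  Finally Xs = Rs^T Rs for a p x n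
   matrix Rs, because its rank is at most p, so Phi(Xs) is the minimum of Psi. *)
Require Import Defs.
From HB Require Import structures.
From mathcomp Require Import all_boot all_order all_algebra.
From mathcomp Require Import all_classical all_reals all_analysis.
From mathcomp Require Import ring lra.

Set Implicit Arguments.
Unset Strict Implicit.
Unset Printing Implicit Defensive.

Import Order.TTheory GRing.Theory Num.Theory.
Import numFieldNormedType.Exports.

Local Open Scope classical_set_scope.
Local Open Scope ring_scope.

(** * Frobenius inner product and its comparison with the entrywise maximum norm *)

Section FrobeniusInner.
Context {K : realType}.

Section Rectangular.
Context {m n : nat}.
Implicit Types A B C : 'M[K]_(m, n).

Lemma innerE A B : inner A B = \sum_i \sum_j A i j * B i j.
Proof.
rewrite /inner /mxtrace exchange_big; apply: eq_bigr => j _.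
by rewrite !mxE; apply: eq_bigr => i _; rewrite mxE.
Qed.

Lemma innerC A B : inner A B = inner B A.
Proof. by rewrite /inner -mxtrace_tr trmx_mul trmxK. Qed.

Lemma innerDr A B C : inner A (B + C) = inner A B + inner A C.
Proof. by rewrite /inner mulmxDr mxtraceD. Qed.

Lemma innerZr a A B : inner A (a *: B) = a * inner A B.
Proof. by rewrite /inner -scalemxAr mxtraceZ. Qed.

Lemma innerDl A B C : inner (A + B) C = inner A C + inner B C.
Proof. by rewrite -!(innerC C) innerDr. Qed.

Lemma innerZl a A B : inner (a *: A) B = a * inner A B.
Proof. by rewrite -!(innerC B) innerZr. Qed.

Lemma innerNr A B : inner A (- B) = - inner A B.
Proof. by rewrite -scaleN1r innerZr mulN1r. Qed.

Lemma innerNl A B : inner (- A) B = - inner A B.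
Proof. by rewrite -!(innerC B) innerNr. Qed.

Definition innerlin := (innerDl, innerDr, innerNl, innerNr, innerZl, innerZr).

Lemma inner_sumr I (r : seq I) (F : I -> 'M[K]_(m, n)) A :
  inner A (\sum_(i <- r) F i) = \sum_(i <- r) inner A (F i).
Proof. by rewrite /inner mulmx_sumr raddf_sum. Qed.

Lemma inner_ge0 A : 0 <= inner A A.
Proof.
by rewrite innerE; do 2 apply: sumr_ge0 => ? _; rewrite -expr2 sqr_ge0.
Qed.

(** Some entry attains the maximum norm, and its square is one term of a sum of squares. Together
    with [inner_le_sqr_norm] this lets Frobenius estimates feed topological statements, which use
    the maximum norm. *)
Lemma sqr_norm_le_inner A : `|A| ^+ 2 <= inner A A.
Proof.
have [->|A0] := eqVneq A 0; first by rewrite normr0 expr0n inner_ge0.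
have [|[i j] Aij] := @mx_norm_neq0 _ _ _ A.
  by rewrite -[mx_norm A]/(`|A|) normr_eq0.
rewrite -[`|A|]/(mx_norm A) Aij innerE (bigD1 i) //= (bigD1 j) //=.
rewrite real_normK ?num_real// -expr2.
rewrite -addrA lerDl addr_ge0 // ?sumr_ge0 // => k _; rewrite -?expr2 ?sqr_ge0 //.
by apply: sumr_ge0 => l _; rewrite -expr2 sqr_ge0.
Qed.

Lemma mxE_le_norm A i j : `|A i j| <= `|A|.
Proof.
rewrite [leRHS]/Num.norm /= mx_normrE.
exact: (le_bigmax _ (fun k => `|A k.1 k.2|) (i, j)).
Qed.

Lemma inner_le_norm A B : `|inner A B| <= (m * n)%:R * `|A| * `|B|.
Proof.
rewrite innerE (le_trans (ler_norm_sum _ _ _)) //.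
apply: (@le_trans _ _ (\sum_(i < m) \sum_(j < n) `|A| * `|B|)).
  apply: ler_sum => i _; rewrite (le_trans (ler_norm_sum _ _ _)) //.
  by apply: ler_sum => j _; rewrite normrM ler_pM ?mxE_le_norm.
by rewrite !sumr_const !card_ord -mulrnA -mulrA mulr_natl mulnC.
Qed.

Lemma inner_le_sqr_norm A : inner A A <= (m * n)%:R * `|A| ^+ 2.
Proof.
by rewrite (le_trans (ler_norm _)) // (le_trans (inner_le_norm _ _)) // mulrA.
Qed.

Lemma inner_eq0 A : inner A A = 0 -> A = 0.
Proof.
move=> A0; apply/normr0_eq0/eqP; rewrite -sqrf_eq0 eq_le sqr_ge0 andbT.
by rewrite -A0 sqr_norm_le_inner.
Qed.

Lemma eq_inner A B : (forall C, inner A C = inner B C) -> A = B.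
Proof.
move=> AB; apply/eqP; rewrite -subr_eq0; apply/eqP/inner_eq0.
by rewrite innerDl innerNl AB subrr.
Qed.

Lemma sqr_frob_norm A : frob_norm A ^+ 2 = inner A A.
Proof. by rewrite sqr_sqrtr ?inner_ge0. Qed.

Lemma frob_norm_ge0 A : 0 <= frob_norm A.
Proof. exact: sqrtr_ge0. Qed.

(** Cauchy-Schwarz: expand the squared norm of [inner B B *: A - inner A B *: B], which is
    nonnegative, and divide by [inner B B]. *)
Lemma sqr_inner_le A B : inner A B ^+ 2 <= inner A A * inner B B.
Proof.
have [->|B0] := eqVneq B 0.
  by rewrite -(scale0r 0) !innerZr !mul0r mulr0 expr0n.
have BB : 0 < inner B B.
  by rewrite lt_def inner_ge0 andbT; apply: contraNneq B0 => /inner_eq0 ->.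
rewrite -subr_ge0 -(pmulr_rge0 _ BB).
have := inner_ge0 (inner B B *: A - inner A B *: B).
rewrite !innerlin (innerC B A); congr (0 <= _); ring.
Qed.

Lemma inner_le_frob A B : inner A B <= frob_norm A * frob_norm B.
Proof.
rewrite -sqrtrM ?inner_ge0 // (le_trans (ler_norm _)) // -sqrtr_sqr.
by rewrite ler_wsqrtr // sqr_inner_le.
Qed.

End Rectangular.

Lemma norm_trmx m n (A : 'M[K]_(m, n)) : `|A^T| = `|A|.
Proof.
suff le_tr p q (C : 'M[K]_(p, q)) : `|C^T| <= `|C|.
  by apply/eqP; rewrite eq_le le_tr -{1}(trmxK A) le_tr.
rewrite [leLHS]/Num.norm /= mx_normrE; apply: bigmax_le => // -[i j] _ /=.
by rewrite mxE mxE_le_norm.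
Qed.

Lemma inner_mull p q r (A : 'M[K]_(q, p)) (B : 'M[K]_(p, r)) (C : 'M[K]_(q, r)) :
  inner (A *m B) C = inner B (A^T *m C).
Proof. by rewrite /inner trmx_mul mulmxA. Qed.

End FrobeniusInner.

(** * Linear structure and completeness of the space of symmetric matrices *)

Section SymmetricSpace.
Context {K : realType} {n : nat}.
Implicit Types X Y : symmx K n.

Lemma symmx_tr X : (X : 'M[K]_n)^T = X.
Proof. exact/symmetricmxP/symmx_valP. Qed.

Lemma symmx_valD X Y : symmx_val (X + Y) = symmx_val X + symmx_val Y.
Proof. by []. Qed.

Lemma symmx_valN X : symmx_val (- X) = - symmx_val X.
Proof. by []. Qed.

Lemma symmx_valZ a X : symmx_val (a *: X) = a *: symmx_val X.
Proof. by []. Qed.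

Lemma symmx_val0 : symmx_val 0 = 0 :> 'M[K]_n.
Proof. by []. Qed.

Definition symmx_valE := (symmx_valD, symmx_valN, symmx_valZ, symmx_val0).

Lemma symmx_val_sum I (r : seq I) (F : I -> symmx K n) :
  symmx_val (\sum_(i <- r) F i) = \sum_(i <- r) symmx_val (F i).
Proof. exact: (big_morph _ symmx_valD symmx_val0). Qed.

Lemma inner_symmx X (Y : 'M[K]_n) : inner X Y = \tr ((X : 'M[K]_n) *m Y).
Proof. by rewrite /inner symmx_tr. Qed.

(** The limit is taken in the complete space of all matrices; it is symmetric because transposition
    preserves the maximum norm. *)
Lemma symmx_cauchy_cvg (u : nat -> symmx K n) :
  (forall e : K, 0 < e -> exists N, forall k l, (N <= k)%N -> (N <= l)%N ->
     `|u k - u l| < e) ->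
  exists L, forall e : K, 0 < e ->
    exists N, forall k, (N <= k)%N -> `|u k - L| < e.
Proof.
move=> uC; pose v k : 'M[K]_n := symmx_val (u k).
have : cvg (v @ \oo).
  apply/cauchy_cvgP/cauchy_ballP => e e0.
  have [N NP] := uC _ e0.
  exists ([set x | exists2 k, (N <= k)%N & x = v k],
          [set x | exists2 k, (N <= k)%N & x = v k]).
    by split; exists N => // k Nk; exists k.
  move=> -[x z] [/= [k Nk ->] [l Nl ->]].
  by rewrite -ball_normE; exact: (NP k l Nk Nl).
move/cvg_ex => [L0 uL].
have {}uL e : 0 < e -> exists N, forall k, (N <= k)%N -> `|v k - L0| < e.
  move=> e0; move/cvgrPdist_lt: uL => /(_ e e0) [N _ NP]; exists N => k Nk.
  by rewrite distrC; exact: (NP k Nk).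
have symL : L0 \is symmetricmx.
  apply/symmetricmxP/eqP; rewrite -subr_eq0 -normr_eq0 eq_le normr_ge0 andbT.
  apply/ler_addgt0Pr => e e0; rewrite add0r.
  have [N /(_ N (leqnn _)) NP] := uL _ (divr_gt0 e0 (ltr0n _ 2)).
  have -> : L0^T - L0 = (v N - L0) - (v N - L0)^T.
    by rewrite linearB /= [(v N)^T]symmx_tr opprB [RHS]addrC addrA addrNK.
  rewrite (le_trans (ler_normB _ _)) // [leRHS]splitr lerD ?ltW //.
  by rewrite norm_trmx.
by exists (SymMx symL) => e /uL.
Qed.

End SymmetricSpace.

(** * Existence and optimality condition of the proximal point of [h / sigma] *)

Section MoreauProx.
Context {K : realType} {n : nat}.
Variables (h : symmx K n -> \bar K).
Hypotheses (h_convex : econvex h) (h_lsc : lower_semicontinuous h).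
Hypothesis h_proper : eproper h.
Implicit Types U V W X : symmx K n.

Lemma eproper_fin_num X : (h X < +oo)%E -> h X \is a fin_num.
Proof. by move=> hX; rewrite fin_numE h_proper.1 lt_eqF. Qed.

Lemma econvex_fine X Y t : h X \is a fin_num -> h Y \is a fin_num ->
  0 <= t <= 1 -> h (t *: X + (1 - t) *: Y) \is a fin_num /\
  fine (h (t *: X + (1 - t) *: Y)) <= t * fine (h X) + (1 - t) * fine (h Y).
Proof.
move=> hX hY t01; have := h_convex X Y t01.
rewrite -{1}(fineK hX) -{1}(fineK hY) -!EFinM -EFinD => le_h.
have hfin := eproper_fin_num (le_lt_trans le_h (ltry _)).
by split=> //; rewrite -lee_fin fineK.
Qed.

(** If [h V] exceeded [c], a real [a] strictly between them would bound [h] from below near [V],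
    contradicting a nearby point with value at most [c + (a - c)]. *)
Lemma lsc_le V (c : K) :
  (forall e : K, 0 < e -> exists W : symmx K n,
    [/\ `|W - V| < e, h W \is a fin_num & fine (h W) <= c + e]) ->
  (h V <= c%:E)%E.
Proof.
move=> hV; rewrite leNgt; apply/negP => chV.
have [a ca ahV] : exists2 a, c < a & (a%:E < h V)%E.
  case: (h V) chV => [r||//].
    by rewrite lte_fin => cr; exists ((c + r) / 2); rewrite ?lte_fin midf_lt.
  by move=> _; exists (c + 1); rewrite ?ltry // ltrDl.
have [T /nbhs_ballP[d /= d0 dT] Ta] := h_lsc ahV.
have m0 : 0 < Num.min d (a - c) by rewrite lt_min d0 subr_gt0.
have [W [WV hW]] := hV _ m0; apply/negP; rewrite -ltNge.
have : (a%:E < h W)%E.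
  apply/Ta/dT; rewrite -ball_normE /= distrC (lt_le_trans WV) //.
  by rewrite ge_min lexx.
rewrite -(fineK hW) lte_fin; apply: le_lt_trans.
by rewrite -lerBrDl ge_min lexx orbT.
Qed.

(* Lower semicontinuity bounds h below near a point of its domain, and
   convexity propagates this to an affine bound in the distance. *)
Lemma lsc_convex_lower_bound : exists (X : symmx K n) (al be : K),
  0 <= be /\ forall V, h V \is a fin_num -> al - be * `|V - X| <= fine (h V).
Proof.
have [X /eproper_fin_num hX] := h_proper.2.
have : ((fine (h X) - 1)%:E < h X)%E.
  by rewrite -{2}(fineK hX) lte_fin ltrBlDr ltrDl.
move=> /h_lsc[T /nbhs_ballP[d /= d0 dT] Ta].
exists X, (fine (h X) - 2), (2 / d); split=> [|V hV].
  by rewrite divr_ge0 // ltW.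
pose r := `|V - X|; have r0 : 0 <= r by exact: normr_ge0.
have rd : 0 < r + d by rewrite ltr_wpDl.
(* This [t] moves the convex combination to within [d] of [X]. Its inverse [2 + 2 * r / d] is the
   source of both constants of the affine bound. *)
pose t := d / (2 * (r + d)).
have t0 : 0 < t by rewrite divr_gt0 // mulr_gt0.
have t1 : t <= 1 by rewrite ler_pdivrMr ?mulr_gt0 // mul1r /t; lra.
have t01 : 0 <= t <= 1 by rewrite ltW.
have [hW le_hW] := econvex_fine hV hX t01.
have : ((fine (h X) - 1)%:E < h (t *: V + (1 - t) *: X)%R)%E.
  apply/Ta/dT; rewrite -ball_normE /= distrC scalerBl scale1r addrCA addrAC.
  rewrite subrr add0r -scalerBr normrZ gtr0_norm // -/r /t mulrAC.
  by rewrite ltr_pdivrMr ?mulr_gt0 // ltr_pM2l //; lra.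
rewrite -(fineK hW) lte_fin => /lt_le_trans/(_ le_hW) lt_h.
have tE : t * (2 * (r + d)) = d by rewrite divfK // gt_eqF // mulr_gt0.
rewrite -/r -(ler_pM2l t0).
have -> : t * (fine (h X) - 2 - 2 / d * r) = t * fine (h X) - 1.
  transitivity (t * fine (h X) - t * (2 * (r + d) / d)).
    by field; exact: lt0r_neq0.
  by rewrite mulrA tE divff // lt0r_neq0.
lra.
Qed.

Variables (sigma : K) (w : symmx K n).
Hypothesis sigma_gt0 : 0 < sigma.

Let J V := fine (h V) + sigma / 2 * inner (V - w) (V - w).

(** The quadratic term dominates the linear decrease allowed by the affine bound; completing the
    square produces the constant [be ^+ 2 / (2 * sigma)]. *)
Lemma prox_obj_bounded_below : exists c : K, forall V, h V \is a fin_num -> c <= J V.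
Proof.
have [X [al [be [be0 lb]]]] := lsc_convex_lower_bound.
exists (al - be * `|w - X| - be ^+ 2 / (2 * sigma)) => V /lb; rewrite /J => lbV.
have : `|V - X| <= `|V - w| + `|w - X|.
  by rewrite (le_trans _ (ler_normD _ _)) // addrA subrK.
move=> /(ler_wpM2l be0); rewrite mulrDr => tri.
have := sqr_norm_le_inner (V - w : symmx K n).
rewrite -(ler_pM2l (divr_gt0 sigma_gt0 (ltr0n _ 2))) => sq.
have : be * `|V - w| <= sigma / 2 * `|V - w| ^+ 2 + be ^+ 2 / (2 * sigma).
  rewrite -subr_ge0.
  have -> : sigma / 2 * `|V - w| ^+ 2 + be ^+ 2 / (2 * sigma) - be * `|V - w|
    = (sigma * `|V - w| - be) ^+ 2 / (2 * sigma) by field; exact: lt0r_neq0.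
  by rewrite divr_ge0 ?sqr_ge0 // mulr_ge0 // ltW.
by move: sq; rewrite -[`|symmx_val _|]/(`|V - w|); lra.
Qed.

(** Strong convexity makes a minimizing sequence Cauchy, and lower semicontinuity shows that its
    limit is a minimizer. *)
Lemma prox_min_exists : exists2 P, h P \is a fin_num &
  forall V, h V \is a fin_num -> J P <= J V.
Proof.
pose S := [set J V | V in [set V | h V \is a fin_num]].
have [c cP] := prox_obj_bounded_below.
have lbS : has_lbound S by exists c => _ [V hV <-]; exact: cP.
have infS : has_inf S.
  by split=> //; have [X /eproper_fin_num hX] := h_proper.2; exists (J X), X.
have [dl [dl0 inv_lt]] : exists dl : nat -> K, (forall k, 0 < dl k) /\
    forall e : K, 0 < e -> exists N, forall k, (N <= k)%N -> dl k < e.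
  exists (fun k => k.+1%:R^-1); split=> // e e0.
  by have [N _ NP] := near_infty_natSinv_lt (PosNum e0); exists N => k /NP.
have /choice[u uP] (k : nat) : exists V,
    h V \is a fin_num /\ J V < inf S + dl k.
  by have [_ [V hV <-] ltV] := inf_adherent (dl0 k) infS; exists V.
have infP V : h V \is a fin_num -> inf S <= J V.
  by move=> hV; apply: ge_inf => //; exists V.
(* Evaluate [J] at the midpoint: convexity of [h] and the parallelogram law for the quadratic term
   leave the gap [sigma / 4 * inner (V - W) (V - W)]. *)
have strong V W : h V \is a fin_num -> h W \is a fin_num ->
    sigma / 4 * inner (V - W) (V - W) <= J V + J W - 2 * inf S.
  move=> hV hW; have half01 : 0 <= (2^-1 : K) <= 1 by lra.
  have [hM le_hM] := econvex_fine hV hW half01.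
  have := infP _ hM; rewrite /J !symmx_valE !innerlin.
  rewrite !(innerC (symmx_val W)) !(innerC (symmx_val w)) in le_hM *.
  by lra.
have [|L LP] := @symmx_cauchy_cvg _ _ u.
  move=> e e0; have [|N NP] := inv_lt (sigma / 8 * e ^+ 2).
    by rewrite mulr_gt0 ?divr_gt0 ?exprn_gt0.
  exists N => k l /NP ltk /NP ltl.
  rewrite -(ltr_pXn2r (_ : 0 < 2)%N) ?nnegrE ?normr_ge0 ?ltW //.
  have := strong _ _ (uP k).1 (uP l).1.
  have := (uP k).2; have := (uP l).2.
  have := sqr_norm_le_inner (u k - u l : symmx K n).
  rewrite -[`|symmx_val _|]/(`|u k - u l|) => le1 lt1 lt2 le2.
  rewrite -(ltr_pM2l (divr_gt0 sigma_gt0 (ltr0n _ 4))).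
  apply: le_lt_trans (ler_wpM2l _ le1) _; first by rewrite divr_ge0 ?ltW.
  by lra.
(* The bound [h L <= c'] is a rearrangement of [J L <= inf S]. *)
pose c' := inf S - sigma / 2 * inner (L - w) (L - w).
have hL : (h L <= c'%:E)%E.
  apply: lsc_le => e e0.
  pose C := sigma * (n * n)%:R * `|L - w|.
  have C0 : 0 <= C by rewrite !mulr_ge0 // ltW.
  have C1 : 0 < 2 * (C + 1) by lra.
  have [|N1 N1P] := inv_lt (e / 2); first by lra.
  have [|N2 N2P] := LP (Num.min e (e / (2 * (C + 1)))).
    by rewrite lt_min e0 divr_gt0.
  have /N1P lt1 := leq_maxl N1 N2; have /N2P := leq_maxr N1 N2.
  set k := maxn N1 N2; rewrite lt_min => /andP[lt2 lt3].
  exists (u k); split=> //; first exact: (uP k).1.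
  have := (uP k).2; rewrite /J /c'.
  have -> : inner (u k - w : symmx K n) (u k - w : symmx K n) =
      inner (L - w : symmx K n) (L - w : symmx K n)
      + 2 * inner (L - w : symmx K n) (u k - L : symmx K n)
      + inner (u k - L : symmx K n) (u k - L : symmx K n).
    rewrite !symmx_valE !innerlin.
    by rewrite !(innerC (symmx_val (u k))) !(innerC (symmx_val w)); ring.
  have := inner_ge0 (u k - L : symmx K n).
  have := inner_le_norm (L - w : symmx K n) (u k - L : symmx K n).
  rewrite -[`|symmx_val (L - w)|]/(`|L - w|) -[`|symmx_val (u k - L)|]/(`|u k - L|).
  rewrite ler_norml => /andP[le1 _] ge0 lt4.
  have : C * `|u k - L| <= e / 2.
    rewrite (le_trans (ler_wpM2l C0 (ltW lt3))) // mulrA ler_pdivrMr //; nra.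
  move: le1; rewrite -(ler_pM2l sigma_gt0) mulrN !mulrA -/C => le1 le2.
  have := mulr_ge0 (ltW sigma_gt0) ge0.
  lra.
have hLf := eproper_fin_num (le_lt_trans hL (ltry _)).
exists L => // V hV; apply: le_trans (infP _ hV).
by rewrite /J -lerBrDr -lee_fin fineK.
Qed.

(** First-order optimality: compare the minimizer [P] with points [t *: V + (1 - t) *: P] for small
    [t]. Thus [sigma *: (w - P)] is a subgradient of [h] at [P]. *)
Lemma prox_subgradient : exists2 P, h P \is a fin_num &
  forall V, ((fine (h P) + sigma * inner (w - P) (V - P))%:E <= h V)%E.
Proof.
have [P hP Pmin] := prox_min_exists; exists P => // V.
have [hV|] := boolP (h V \is a fin_num); last first.
  by rewrite fin_numE h_proper.1 negbK => /eqP->; rewrite leey.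
rewrite -(fineK hV) lee_fin.
pose q := inner (V - P) (V - P); have q0 : 0 <= q := inner_ge0 _.
apply/ler_addgt0Pr => e e0.
(* Chosen so that [t * (sigma * q) <= e]: the term of order [t ^+ 2] is absorbed by [t * e]. *)
pose t := e / (e + sigma * q).
have eq0 : 0 < e + sigma * q by rewrite ltr_wpDr // mulr_ge0 // ltW.
have t0 : 0 < t by rewrite divr_gt0.
have t1 : t <= 1 by rewrite ler_pdivrMr // mul1r lerDl mulr_ge0 // ltW.
have tq : t * (sigma * q) <= e.
  rewrite mulrAC ler_pdivrMr // ler_pM2l // lerDr ltW //.
have t01 : 0 <= t <= 1 by rewrite ltW.
have [hM le_hM] := econvex_fine hV hP t01.
have := Pmin _ hM; rewrite /J.
have -> : inner (t *: V + (1 - t) *: P - w) (t *: V + (1 - t) *: P - w)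
  = inner (P - w) (P - w) - 2 * t * inner (w - P) (V - P) + t ^+ 2 * q.
  rewrite /q !symmx_valE !innerlin.
  by rewrite !(innerC (symmx_val V)) !(innerC (symmx_val w) (symmx_val P)); ring.
move: le_hM; set i1 := inner _ _; set i2 := inner _ _ => le_hM le1.
rewrite -(ler_pM2l t0).
have : t ^+ 2 * (sigma * q) <= t * e by rewrite expr2 -mulrA ler_pM2l.
have : 0 <= t * e by rewrite mulr_ge0 ?ltW.
lra.
Qed.

End MoreauProx.

(** * Differentiability from quadratic remainders, and tangents of convex functions *)

Section FirstOrder.
Context {K : realType}.

(** A quadratic remainder is little-o of the increment; the bound on [L] supplies the continuity
    required of a differential. *)
Lemma differentiable_sqr_remainder (V W : normedModType K) (F : V -> W)
    (L : V -> W) (x : V) (C D : K) :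
  linear L -> (forall v, `|L v| <= D * `|v|) ->
  (forall v, `|F (x + v) - F x - L v| <= C * `|v| ^+ 2) ->
  differentiable F x /\ 'd F x = L :> (V -> W).
Proof.
move=> linL bL remF.
pose L' : {linear V -> W} := HB.pack L (GRing.isLinear.Build _ _ _ _ L linL).
have cL : continuous L'.
  apply/bounded_linear_continuous/bounded_funP => r; exists (`|D| * `|r|) => v vr.
  rewrite (le_trans (bL v)) // (le_trans (ler_norm _)) // normrM ler_wpM2l //.
  by rewrite normr_id (le_trans vr) // ler_norm.
have oF : F \o shift x = cst (F x) + L' +o_ 0 id.
  apply/eqaddoP => e e0; near=> v.
  rewrite /= !fctE opprD addrA [v + x]addrC (le_trans (remF v)) //.
  rewrite expr2 mulrA ler_wpM2r // (le_trans (ler_norm _)) // normrM normr_id.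
  have C1 : 0 < `|C| + 1 by rewrite ltr_wpDl.
  have ve : `|v| < e / (`|C| + 1).
    near: v; apply/nbhs0_lt; rewrite divr_gt0 //.
  move: ve; rewrite ltr_pdivlMr // mulrDr mulr1 mulrC => /ltW; apply: le_trans.
  by rewrite lerDl.
have dF := diff_unique cL oF; split; last by rewrite dF.
by apply/diff_locallyP; rewrite dF.
Unshelve. all: by end_near. Qed.

(** Bound [f] at [t *: z + (1 - t) *: x] above by convexity and below by its expansion at [x], then
    divide by a [t] so small that the error is at most [t * e]. *)
Lemma convex_diff_le (V : normedModType K) (f : V -> K) (x z : V) :
  (forall t : K, 0 <= t <= 1 ->
    f (t *: z + (1 - t) *: x) <= t * f z + (1 - t) * f x) ->
  differentiable f x -> f x + 'd f x (z - x) <= f z.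
Proof.
move=> cf /diff_locallyP[_ /eqaddoP of_].
apply/ler_addgt0Pr => e e0.
pose N := `|z - x|; have N_ge0 : 0 <= N by exact: normr_ge0.
have N0 : 0 < N + 1 by rewrite ltr_wpDl.
have /nbhs_ballP[d /= d0 dP] := of_ _ (divr_gt0 e0 N0).
pose t := Num.min 1 (d / (2 * (N + 1))).
have t0 : 0 < t by rewrite lt_min ltr01 divr_gt0 // mulr_gt0.
have t1 : t <= 1 by rewrite ge_min lexx.
have tN : t * N < d.
  apply: (@le_lt_trans _ _ (d / (2 * (N + 1)) * N)).
    by rewrite ler_wpM2r ?normr_ge0 // ge_min lexx orbT.
  by rewrite mulrAC ltr_pdivrMr ?mulr_gt0 // ltr_pM2l //; lra.
have : ball (0 : V) d (t *: (z - x)).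
  by rewrite -ball_normE /= sub0r normrN normrZ gtr0_norm.
move=> /dP; rewrite /= !fctE normrZ (gtr0_norm t0) -/N linearZ /=.
have -> : t *: (z - x) + x = t *: z + (1 - t) *: x.
  by rewrite scalerBr scalerBl scale1r -addrA [- _ + x]addrC.
have t01 : 0 <= t <= 1 by rewrite ltW.
have := cf _ t01.
rewrite ler_norml => le1 /andP[le2 _]; rewrite -(ler_pM2l t0).
have : e / (N + 1) * (t * N) <= t * e.
  rewrite mulrCA ler_pM2l // mulrAC ler_pdivrMr // ler_pM2l //; lra.
move: le2; rewrite -[t *: 'd f x _]/(t * 'd f x (z - x)); lra.
Qed.

End FirstOrder.

(** * Riesz representation on symmetric matrices *)

Section Riesz.
Context {K : realType} {n : nat}.

Lemma sym_part_subproof (A : 'M[K]_n) : 2^-1 *: (A + A^T) \is symmetricmx.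
Proof. by apply/symmetricmxP; rewrite linearZ linearD /= trmxK addrC. Qed.

(** The projection onto symmetric matrices allows a functional on [symmx] to be evaluated at matrix
    units, which need not be symmetric. *)
Definition sym_part (A : 'M[K]_n) : symmx K n := SymMx (sym_part_subproof A).

Lemma sym_part_id (X : symmx K n) : sym_part X = X.
Proof.
by apply: val_inj; rewrite /= symmx_tr; apply/matrixP => i j; rewrite !mxE; field.
Qed.

Lemma sym_part_linear : linear sym_part.
Proof.
by move=> a A B; apply: val_inj; apply/matrixP => i j; rewrite !mxE; ring.
Qed.

Lemma symmx_riesz (L : {linear symmx K n -> K}) :
  exists G : symmx K n, forall X : symmx K n, L X = inner G X.
Proof.
pose s : {linear 'M[K]_n -> symmx K n} :=
  HB.pack sym_part (GRing.isLinear.Build _ _ _ _ sym_part sym_part_linear).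
pose G : 'M[K]_n := \matrix_(i, j) L (sym_part (delta_mx i j)).
have symG : G \is symmetricmx.
  apply/symmetricmxP/matrixP => i j; rewrite !mxE; congr (L _).
  by apply: val_inj; rewrite /= !trmx_delta addrC.
exists (SymMx symG) => X; rewrite innerE -{1}(sym_part_id X).
rewrite {1}(matrix_sum_delta X) -[sym_part _]/(s _) !linear_sum.
apply: eq_bigr => i _; rewrite !linear_sum; apply: eq_bigr => j _.
by rewrite !linearZ /= mxE mulrC.
Qed.

End Riesz.

(** * Moreau's identity for the proximal map of the conjugate *)

Section MoreauIdentity.
Context {K : realType} {n : nat}.
Variables (h : symmx K n -> \bar K) (sigma : K) (w P : symmx K n).
Hypotheses (sigma_gt0 : 0 < sigma) (hP : h P \is a fin_num).
Hypothesis subgrad : forall V : symmx K n,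
  ((fine (h P) + sigma * inner (w - P) (V - P))%:E <= h V)%E.

Lemma conjugate_ge (V : symmx K n) :
  ((inner V P - fine (h P))%:E <= conjugate h V)%E.
Proof. by apply: ereal_sup_ubound; exists P => //; rewrite -{1}(fineK hP). Qed.

(** The Fenchel-Young inequality [conjugate_ge] is an equality at a subgradient. *)
Lemma conjugate_subgradient :
  conjugate h (sigma *: (w - P)) =
  (inner (sigma *: (w - P)) P - fine (h P))%:E.
Proof.
apply/eqP; rewrite eq_le conjugate_ge andbT; apply: ge_ereal_sup => _ [X _ <-].
have := subgrad X; case: (h X) => [r||] //; last by rewrite leNye.
by rewrite !lee_fin !symmx_valE !innerlin; lra.
Qed.

(** Replacing the conjugate by its Fenchel-Young minorant turns the objective into a quadratic
    minimized at [sigma *: (w - P)], where both objectives agree. The excess of half a squared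
    distance makes the minimizer unique, so [prox] must select it. *)
Lemma prox_conjugate :
  prox (fun V => sigma%:E * conjugate h V)%E (sigma *: w) = sigma *: (w - P).
Proof.
set G := sigma *: (w - P).
pose c := sigma * (inner G P - fine (h P))
  + 2^-1 * frob_norm (G - sigma *: w) ^+ 2.
have objG : prox_obj (fun V => sigma%:E * conjugate h V)%E (sigma *: w) G = c%:E.
  by rewrite /prox_obj conjugate_subgradient -EFinM -EFinD.
have objV (V : symmx K n) : ((c + 2^-1 * inner (V - G) (V - G))%:E <=
    prox_obj (fun V => sigma%:E * conjugate h V)%E (sigma *: w) V)%E.
  apply: (@le_trans _ _ (sigma%:E * (inner V P - fine (h P))%:E +
      (2^-1 * frob_norm (V - sigma *: w : symmx K n) ^+ 2)%:E)%E).
    rewrite -EFinM -EFinD lee_fin /c !sqr_frob_norm /G !symmx_valE !innerlin.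
    rewrite !(innerC _ (symmx_val V)) !(innerC (symmx_val P) (symmx_val w)).
    by lra.
  rewrite /prox_obj leeD2r // lee_wpmul2l ?conjugate_ge //.
  by rewrite lee_fin ltW.
have minG : exists V, [set V | forall V',
    (prox_obj (fun V => sigma%:E * conjugate h V) (sigma *: w)%R V <=
     prox_obj (fun V => sigma%:E * conjugate h V) (sigma *: w)%R V')%E] V.
  exists G => V; rewrite objG; apply: le_trans (objV V).
  by rewrite lee_fin lerDl mulr_ge0 ?invr_ge0 ?inner_ge0.
have := xgetPex 0 minG G; rewrite objG -/(prox _ _) => /(le_trans (objV _)).
rewrite lee_fin => le0.
set V := prox _ _ in le0 *.
have /inner_eq0/eqP : inner (V - G) (V - G) = 0.
  by apply/eqP; rewrite eq_le inner_ge0 andbT; lra.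
by rewrite subr_eq0 => /eqP/val_inj.
Qed.

End MoreauIdentity.

(** * Adjointness and boundedness of the trace operators *)

Section TraceOperator.
Context {K : realType} {n k : nat}.
Variables (C : 'I_k -> symmx K n).

Lemma trace_opD (Y Y' : 'M[K]_n) :
  trace_op C (Y + Y') = trace_op C Y + trace_op C Y'.
Proof. by apply/rowP => i; rewrite !mxE mulmxDr mxtraceD. Qed.

Lemma trace_opN (Y : 'M[K]_n) : trace_op C (- Y) = - trace_op C Y.
Proof. by apply/rowP => i; rewrite !mxE mulmxN linearN. Qed.

Lemma inner_row (u v : 'rV[K]_k) : inner u v = \sum_i u 0 i * v 0 i.
Proof. by rewrite innerE big_ord1. Qed.

Lemma inner_trace_op_adj (u : 'rV[K]_k) (Y : 'M[K]_n) :
  inner (trace_op_adj C u) Y = inner u (trace_op C Y).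
Proof.
rewrite /trace_op_adj symmx_val_sum innerC inner_sumr inner_row.
by apply: eq_bigr => i _; rewrite symmx_valZ innerZr mxE innerC inner_symmx.
Qed.

Lemma trace_op_sqr_le : exists D : K, forall Y : 'M[K]_n,
  inner (trace_op C Y) (trace_op C Y) <= D * `|Y| ^+ 2.
Proof.
exists (\sum_i ((n * n)%:R * `|C i|) ^+ 2) => Y.
rewrite inner_row mulr_suml; apply: ler_sum => i _.
rewrite mxE -inner_symmx -expr2 -exprMn -real_normK ?num_real //.
rewrite lerXn2r ?nnegrE ?normr_ge0 ?mulr_ge0 ?normr_ge0 //.
exact: inner_le_norm.
Qed.

End TraceOperator.

(** * Differentiability and tangent inequality of [Phi] *)

Section PenalizedObjective.
Context {K : realType} {n m : nat}.
Variables (f : symmx K n -> K) (h : symmx K n -> \bar K).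
Variables (A : 'I_m -> symmx K n) (b y : 'rV[K]_m) (Z : symmx K n) (sigma : K).
Hypotheses (sigma_gt0 : 0 < sigma).
Hypotheses (h_convex : econvex h) (h_lsc : lower_semicontinuous h).
Hypothesis h_proper : eproper h.

(* The Moreau envelope of h / sigma lies between its tangent and that tangent
   plus sigma / 2 |v|^2, and is therefore convex and differentiable. *)
Lemma Phi_split :
  exists (g : symmx K n -> K) (dg : symmx K n -> symmx K n) (C : K),
  (forall X, Phi f h A b y Z sigma X = f X + g X) /\
  forall X v : symmx K n,
    0 <= g (X + v) - g X - inner (dg X) v <= C * `|v| ^+ 2.
Proof.
have /choice[P PP] (w : symmx K n) : exists P, h P \is a fin_num /\
    forall V : symmx K n,
      ((fine (h P) + sigma * inner (w - P) (V - P))%:E <= h V)%E.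
  by have [P] := prox_subgradient h_convex h_lsc h_proper w sigma_gt0; exists P.
pose c := b + sigma^-1 *: y.
pose w X := X - sigma^-1 *: Z.
pose r X := trace_op A X - c.
(* By Moreau's identity the argument of [h] in [Phi] becomes [P (w X)], where [h] is finite. *)
have TkE X : Tk h Z sigma X = w X - P (w X).
  rewrite /Tk.
  have -> : sigma *: X - Z = sigma *: w X.
    by rewrite scalerBr scalerA divff ?scale1r // lt0r_neq0.
  rewrite (prox_conjugate sigma_gt0 (PP _).1 (PP _).2).
  by rewrite scalerA mulVf ?scale1r // lt0r_neq0.
pose e w := fine (h (P w)) + sigma / 2 * inner (w - P w) (w - P w).
pose q X := sigma / 2 * inner (r X) (r X).
pose dq X := sigma *: trace_op_adj A (r X).
have [D DP] := trace_op_sqr_le A.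
pose C := sigma / 2 * ((n * n)%:R + D).
exists (fun X => e (w X) + q X), (fun X => sigma *: (w X - P (w X)) + dq X), C.
split=> [X|X v].
  rewrite /Phi TkE !sqr_frob_norm.
  have -> : X - sigma^-1 *: Z - (w X - P (w X)) = P (w X) by rewrite subKr.
  have -> : trace_op A X - b - sigma^-1 *: y = r X by rewrite /r /c opprD addrA.
  rewrite /e /q; ring.
have -> : w (X + v) = w X + v by rewrite /w addrAC.
(* With [u] for [w X], the lower half uses the subgradient at [P u] tested at [P (u + v)], and the
   square of the difference of the residuals. The upper half uses the subgradient at [P (u + v)]
   tested at [P u], and the square of the difference of the proximal points. *)
have envelope : 0 <= e (w X + v) - e (w X) - inner (sigma *: (w X - P (w X))) v
    <= sigma / 2 * inner v v.
  move: (w X) => {X} u; rewrite /e.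
  have [hP lbP] := PP u; have [hQ lbQ] := PP (u + v).
  move: (P u) (P (u + v)) hP hQ lbP lbQ => p q' hP hQ /(_ q') + /(_ p).
  rewrite -{2}(fineK hP) -{1}(fineK hQ) !lee_fin => h4 h3.
  have := inner_ge0 (u - p - (u + v - q') : symmx K n).
  have := inner_ge0 (p - q' : symmx K n).
  move=> /(mulr_ge0 (ltW sigma_gt0)) h1 /(mulr_ge0 (ltW sigma_gt0)) h2.
  move: h1 h2 h3 h4; rewrite !symmx_valE !innerlin.
  rewrite !(innerC (symmx_val v)) !(innerC _ (symmx_val u)).
  rewrite !(innerC (symmx_val q') (symmx_val p)).
  move=> h1 h2 h3 h4; apply/andP; split; lra.
have r_tr : r (X + v) = r X + trace_op A v.
  by rewrite /r symmx_valD trace_opD addrAC.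
have qE : q (X + v) - q X - inner (dq X) v
    = sigma / 2 * inner (trace_op A v) (trace_op A v).
  rewrite /q r_tr /dq symmx_valZ innerZl inner_trace_op_adj.
  by move: (r X) => rX; rewrite !innerlin (innerC _ rX); field.
have -> : e (w X + v) + q (X + v) - (e (w X) + q X)
      - inner (sigma *: (w X - P (w X)) + dq X) v
    = e (w X + v) - e (w X) - inner (sigma *: (w X - P (w X))) v
      + sigma / 2 * inner (trace_op A v) (trace_op A v).
  rewrite -qE symmx_valD innerDl; ring.
have s2 : 0 <= sigma / 2 by rewrite divr_ge0 ?ltW.
case/andP: envelope => env_ge env_le.
rewrite (addr_ge0 env_ge (mulr_ge0 s2 (inner_ge0 _))) /=.
rewrite (le_trans (lerD env_le (lexx _))) // -mulrDr /C -mulrA ler_wpM2l //.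
by rewrite mulrDl lerD ?DP ?inner_le_sqr_norm.
Qed.

(** In the splitting [f + g], the two-sided remainder bound makes [g] differentiable. The tangent
    inequality combines convexity of [f] with nonnegativity of the remainder of [g]. *)
Lemma Phi_first_order
    (f_convex : convex_function [set: convex_lmodType (symmx K n)] f)
    (f_diff : forall X, differentiable f X) (X : symmx K n) :
  [/\ differentiable (Phi f h A b y Z sigma) X,
      (forall v, 'd (Phi f h A b y Z sigma) X v =
        inner (gradS (Phi f h A b y Z sigma) X) v)
    & forall Y : symmx K n, Phi f h A b y Z sigma X
        + inner (gradS (Phi f h A b y Z sigma) X) (Y - X)
        <= Phi f h A b y Z sigma Y].
Proof.
have [g [dg [C [PhiE remg]]]] := Phi_split.
have -> : Phi f h A b y Z sigma = f + g by apply/funext => Y; rewrite PhiE.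
have [||v|diff_g dgE] := @differentiable_sqr_remainder K (symmx K n) K g
    (fun v => inner (dg X) v) X C ((n * n)%:R * `|dg X|).
- by move=> a u v; rewrite symmx_valD symmx_valZ !innerlin.
- by move=> v; exact: inner_le_norm.
- by have /andP[ge0 le1] := remg X v; rewrite ger0_norm.
have diff_fg : differentiable (f + g) X.
  exact: (differentiableD (f_diff X) diff_g).
have gradE : [set G : symmx K n | forall v, 'd (f + g) X v = inner G v]
    (gradS (f + g) X) by apply: xgetPex; exact: symmx_riesz.
split=> // Y; rewrite -gradE diffD //= !fctE dgE.
have : f X + 'd f X (Y - X) <= f Y.
  apply: convex_diff_le => // t /andP[t0 t1].
  have := f_convex (Itv01 t0 t1) Y X; rewrite !inE => /(_ I I).
  by [].
have /andP[+ _] := remg X (Y - X); rewrite addrCA subrr addr0; lra.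
Qed.

End PenalizedObjective.

(** * Gram factorization of positive semidefinite matrices of bounded rank *)

Section PsdFactorization.
Context {K : realType} {n : nat}.

Lemma quad_formE (X : 'M[K]_n) (v w : 'cV[K]_n) :
  (v^T *m X *m w) 0 0 = inner v (X *m w).
Proof. by rewrite /inner -mulmxA trace_mx11. Qed.

Lemma inner_mul_sym (X : 'M[K]_n) (v w : 'cV[K]_n) : X^T = X ->
  inner v (X *m w) = inner w (X *m v).
Proof. by move=> sX; rewrite innerC inner_mull sX. Qed.

(* Symmetric elimination: if a = v^T X v > 0 then X - X v v^T X / a is again
   positive semidefinite, and its rank is smaller because it kills v. *)
Lemma psd_gram (k : nat) (X : 'M[K]_n) :
  X^T = X -> psd X -> (\rank X <= k)%N -> exists R : 'M[K]_(k, n), R^T *m R = X.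
Proof.
elim: k X => [|k IHk] X sX pX rX.
  by exists 0; rewrite mulmx0; apply/esym/eqP; rewrite -mxrank_eq0 -leqn0.
have [->|X0] := eqVneq X 0; first by exists 0; rewrite mulmx0.
(* Otherwise the quadratic form vanishes identically, and polarization forces [X = 0]. *)
have [v v_gt0] : exists v : 'cV[K]_n, 0 < inner v (X *m v).
  apply: contrapT => /forallNP noV; move/negP: X0; apply; apply/eqP.
  have q0 (v : 'cV[K]_n) : inner v (X *m v) = 0.
    apply/eqP; rewrite eq_le -quad_formE pX andbT quad_formE.
    by rewrite leNgt; apply/negP/noV.
  apply/matrixP => i j; rewrite -[X]mulmx1 -[in LHS](trmx1 K n).
  have vw (v w : 'cV[K]_n) : inner v (X *m w) = 0.
    have := q0 (v + w); rewrite mulmxDr !innerlin !q0 (inner_mul_sym w v sX).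
    by move=> e; lra.
  have Xw (w : 'cV[K]_n) : X *m w = 0 by apply: inner_eq0; exact: vw.
  have := Xw (delta_mx j 0); move=> /matrixP/(_ i 0).
  by rewrite -colE mxE trmx1 mulmx1 !mxE => ->.
set a := inner v (X *m v) in v_gt0.
have a0 : a != 0 := lt0r_neq0 v_gt0.
pose X' := X - a^-1 *: (X *m v *m (v^T *m X)).
have X'w (w : 'cV[K]_n) :
    X' *m w = X *m w - (a^-1 * inner v (X *m w)) *: (X *m v).
  rewrite mulmxBl -scalemxAl -scalerA; congr (_ - _ *: _).
  rewrite -[X in X = _]mulmxA [v^T *m X *m w]mx11_scalar quad_formE.
  by rewrite mul_mx_scalar.
have sX' : X'^T = X'.
  by rewrite /X' linearB linearZ /= !trmx_mul trmxK sX.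
have pX' : psd X'.
  move=> w; rewrite quad_formE X'w !innerlin (inner_mul_sym w v sX).
  (* At this vector the form of [X] equals [a ^+ 2] times the form of [X'] at [w]. *)
  have := pX (a *: w - inner v (X *m w) *: v); rewrite quad_formE.
  rewrite mulmxDr mulmxN -!scalemxAr !innerlin (inner_mul_sym w v sX) -/a.
  set c := inner v (X *m w); set d := inner w (X *m w) => ge0.
  rewrite -(pmulr_rge0 _ (exprn_gt0 2 v_gt0)).
  have -> : a ^+ 2 * (d - a^-1 * c * c) = a ^+ 2 * d - a * c * c by field.
  by move: ge0; lra.
have rX' : (\rank X' <= k)%N.
  rewrite -ltnS (leq_trans _ rX) //.
  have X'X : (X' <= X)%MS.
    rewrite /X' addmx_sub // eqmx_opp scalemx_sub // mulmxA submxMl //.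
  rewrite ltn_neqAle mxrankS // andbT.
  rewrite (mxrank_leqif_sup X'X); apply/negP => /submxP[D XD].
  have : X *m v = 0.
    by rewrite XD -mulmxA X'w -/a mulVf // scale1r subrr mulmx0.
  by move=> Xv0; move/eqP: a0; apply; rewrite /a Xv0 -(scale0r 0) innerZr mul0r.
have [R' R'X] := IHk _ sX' pX' rX'.
(* The extra row contributes exactly the rank-one matrix removed from [X]. *)
pose R : 'M[K]_(1 + k, n) := col_mx (Num.sqrt a^-1 *: (v^T *m X)) R'.
suff RX : R^T *m R = X by exists R.
rewrite /R tr_col_mx mul_row_col R'X [(_ *: _)^T]linearZ /= -scalemxAl -scalemxAr.
rewrite scalerA -expr2 sqr_sqrtr ?invr_ge0 ?ltW // trmx_mul trmxK sX.
by rewrite /X' addrC subrK.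
Qed.

Lemma psd_gram_ge0 (p : nat) (R : 'M[K]_(p, n)) : psd (gram R).
Proof. by move=> v; rewrite quad_formE /= -mulmxA -inner_mull inner_ge0. Qed.

(** The inner product is the sum of the values of the quadratic form of [M] at the rows of [R]. *)
Lemma psd_inner_gram (p : nat) (M : 'M[K]_n) (R : 'M[K]_(p, n)) :
  psd M -> 0 <= inner M (gram R).
Proof.
move=> pM; rewrite -inner_mull innerE; apply: sumr_ge0 => i _.
have := pM (row i R)^T; rewrite trmxK -row_mul mxE.
by under eq_bigr do rewrite !mxE; under [X in _ -> 0 <= X]eq_bigr do rewrite mxE.
Qed.

End PsdFactorization.

(** * Derivative of the map from [R] to [R^T *m R] *)

Section Gram.
Context {K : realType} {n p : nat}.

Lemma mulmx_norm_le q r s (A : 'M[K]_(q, r)) (B : 'M[K]_(r, s)) :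
  `|A *m B| <= r%:R * `|A| * `|B|.
Proof.
rewrite [leLHS]/Num.norm /= mx_normrE; apply: bigmax_le => [|[i j] _ /=].
  by rewrite !mulr_ge0.
rewrite mxE (le_trans (ler_norm_sum _ _ _)) //.
apply: (@le_trans _ _ (\sum_(k < r) `|A| * `|B|)).
  by apply: ler_sum => k _; rewrite normrM ler_pM ?mxE_le_norm.
by rewrite sumr_const card_ord -mulrA mulr_natl.
Qed.

Lemma sym_part_double (M : 'M[K]_n) : sym_part (2 *: M) = M + M^T :> 'M[K]_n.
Proof. by apply/matrixP => i j; rewrite !mxE; field. Qed.

(** The remainder is exactly [gram U]. The derivative [R^T *m U + U^T *m R] is written through
    [sym_part] to land in [symmx]. *)
Lemma diff_gram (R : 'M[K]_(p, n)) :
  differentiable (@gram K n p) R /\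
  'd (@gram K n p) R = (fun U => sym_part (2 *: (R^T *m U))) :> (_ -> _).
Proof.
apply: (@differentiable_sqr_remainder K _ _ _ _ _ (p%:R) (2 * (p%:R * `|R|))).
- move=> a U V; rewrite -sym_part_linear; congr sym_part.
  by rewrite mulmxDr -scalemxAr scalerDr !scalerA mulrC.
- move=> U; rewrite -[leLHS]/`|symmx_val (sym_part _)| sym_part_double.
  rewrite (le_trans (ler_normD _ _)) // -mulrA mulrDl mul1r lerD //.
    by rewrite (le_trans (mulmx_norm_le _ _)) // norm_trmx.
  by rewrite norm_trmx (le_trans (mulmx_norm_le _ _)) // norm_trmx.
move=> U.
have -> : gram (R + U) - gram R - sym_part (2 *: (R^T *m U)) = gram U.
  apply: val_inj; rewrite -[LHS]/((R + U)^T *m (R + U) - R^T *m R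
    - symmx_val (sym_part (2 *: (R^T *m U)))) sym_part_double.
  rewrite [(R + U)^T]linearD /= mulmxDl !mulmxDr trmx_mul trmxK opprD.
  by apply/matrixP => i j; rewrite !mxE; ring.
rewrite [leLHS]/Num.norm /= /symmx_norm /=.
by rewrite (le_trans (mulmx_norm_le _ _)) // norm_trmx mulrA.
Qed.

End Gram.

(** * Tangent spaces and uniqueness of the projection onto them *)

Section RiemannianGradient.
Context {K : realType} {n m0 p : nat}.
Variables (B : 'I_m0 -> symmx K n) (b0 : 'rV[K]_m0).

Lemma trace_op_tr (Y : 'M[K]_n) : trace_op B Y^T = trace_op B Y.
Proof.
apply/rowP => i; rewrite !mxE -mxtrace_tr trmx_mul trmxK symmx_tr.
exact: mxtrace_mulC.
Qed.

(** The two summands in the tangency condition are transposes of each other, so the symmetric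
    matrices [B i] give them equal traces. *)
Lemma tangentE (R U : 'M[K]_(p, n)) :
  tangent B R U <-> trace_op B (R^T *m U) = 0.
Proof.
rewrite /tangent /= trace_opD -[X in _ + trace_op B X]trmxK trace_op_tr.
rewrite trmx_mul trmxK -mulr2n; split=> [/eqP|->]; last by rewrite mul0rn.
by rewrite -scaler_nat scaler_eq0 pnatr_eq0 => /eqP.
Qed.

Lemma is_proj_unique (R G U V : 'M[K]_(p, n)) :
  is_proj (tangent B R) G U -> is_proj (tangent B R) G V -> U = V.
Proof.
move=> [TU PU] [TV PV]; apply/eqP; rewrite -subr_eq0; apply/eqP/inner_eq0.
have TUV : tangent B R (U - V).
  apply/tangentE; rewrite mulmxBr trace_opD trace_opN.
  by move/tangentE: TU => ->; move/tangentE: TV => ->; rewrite subrr.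
have := PU _ TUV; have := PV _ TUV.
rewrite ![inner (G - _) _]innerDl ![inner (- _) (U - V)]innerNl => e1 e2.
rewrite innerDl innerNl; lra.
Qed.

Lemma Dset_gram (R : 'M[K]_(p, n)) : Mset B b0 p R -> Dset B b0 (gram R).
Proof. by move=> MR; split=> //; exact: psd_gram_ge0. Qed.

End RiemannianGradient.

(** * Existence of the multiplier *)

Section Multiplier.
Context {K : realType} {n m0 p : nat}.
Variables (B : 'I_m0 -> symmx K n) (R : 'M[K]_(p, n)).
Hypothesis licq : free [tuple (B i : 'M[K]_n) *m gram R | i < m0].

(* Linear independence makes the Gram matrix of the R B_i invertible. *)
Lemma multiplier_exists (G : 'M[K]_n) : exists u : 'rV[K]_m0,
  trace_op B (gram R *m (G - trace_op_adj B u)) = 0.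
Proof.
pose M : 'M[K]_m0 := \matrix_(i, j) \tr ((B j : 'M[K]_n) *m (gram R *m B i)).
have uM (u : 'rV[K]_m0) : u *m M = trace_op B (gram R *m trace_op_adj B u).
  apply/rowP => j; rewrite !mxE symmx_val_sum !mulmx_sumr raddf_sum.
  by apply: eq_bigr => i _; rewrite mxE symmx_valZ -!scalemxAr; exact/esym/mxtraceZ.
have : row_free M.
  apply: inj_row_free => u uM0; set W := trace_op_adj B u in uM.
  (* From [u *m M = 0], the squared norm of [R *m W] vanishes. Then [W *m gram R = 0], a linear
     relation with coefficients [u] among the independent [B i *m gram R]. *)
  have RW0 : R *m W = 0.
    apply: inner_eq0; rewrite inner_mull mulmxA inner_trace_op_adj.
    rewrite -[R^T *m R]/(symmx_val (gram R)) -uM uM0 innerC inner_row.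
    by rewrite big1 // => i _; rewrite mxE mul0r.
  have WX0 : (W : 'M[K]_n) *m gram R = 0.
    rewrite -(symmx_tr W) /= mulmxA -trmx_mul RW0 trmx0 mul0mx //.
  apply/rowP => i; rewrite [RHS]mxE; move: i.
  have /freeP/(_ (fun i => u 0 i)) := licq; apply.
  rewrite -[RHS]WX0 /W symmx_val_sum mulmx_suml; apply: eq_bigr => i _.
  by rewrite -tnth_nth tnth_mktuple symmx_valZ scalemxAl.
rewrite row_free_unit => uM1.
exists (trace_op B (gram R *m G) *m invmx M).
by rewrite mulmxBr trace_opD trace_opN -uM mulmxKV // subrr.
Qed.

End Multiplier.

(** * The Riemannian gradient of [Psi] in terms of [Sk] *)

Section PulledBackGradient.
Context {K : realType} {n m m0 p : nat}.
Variables (B : 'I_m0 -> symmx K n).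
Variables (f : symmx K n -> K) (h : symmx K n -> \bar K).
Variables (A : 'I_m -> symmx K n) (b y : 'rV[K]_m) (Z : symmx K n) (sigma : K).
Variable R : 'M[K]_(p, n).

Let Phi' := Phi f h A b y Z sigma.
Let S := Sk B f h A b y Z sigma (gram R).
Hypothesis Phi_diff : differentiable Phi' (gram R).
Hypothesis Phi_grad :
  forall v, 'd Phi' (gram R) v = inner (gradS Phi' (gram R)) v.
Hypothesis licq : free [tuple (B i : 'M[K]_n) *m gram R | i < m0].

Lemma gradM_Psi : gradM (@Psi K n m f h A b y Z sigma p) R
  = 2 *: (R *m gradS Phi' (gram R)).
Proof.
have [diffG dG] := diff_gram R.
have gradE : [set g : 'M[K]_(p, n) | forall v,
      'd (Psi f h A b y Z sigma (p := p)) R v = inner g v]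
    (2 *: (R *m gradS Phi' (gram R))).
  move=> U; rewrite -[Psi _ _ _ _ _ _ _ (p := p)]/(Phi' \o @gram K n p) diff_comp //=.
  rewrite Phi_grad dG sym_part_double innerDr.
  have -> : inner (gradS Phi' (gram R)) (R^T *m U)^T =
      inner (gradS Phi' (gram R)) (R^T *m U).
    by rewrite !inner_symmx -mxtrace_tr trmx_mul trmxK symmx_tr mxtrace_mulC.
  by rewrite innerZl inner_mull; ring.
have := xgetPex 0 (ex_intro _ _ gradE).
rewrite -/(gradient _ _ _) => gE; apply: eq_inner => U.
by rewrite -gradE; exact/esym/gE.
Qed.

Lemma Sk_stationary : trace_op B (gram R *m S) = 0.
Proof. exact: (xgetPex 0 (multiplier_exists licq (gradS Phi' (gram R)))). Qed.

(** Stationarity of [S] makes [2 *: (R *m S)] tangent. The Euclidean gradient differs from it by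
    twice [R] times a combination of the [B i], which is orthogonal to every tangent [W] since
    [trace_op B (R^T *m W) = 0]. *)
Lemma rgradPsiE : rgradPsi B f h A b y Z sigma R = 2 *: (R *m S).
Proof.
have proj : is_proj (tangent B R) (gradM (Psi f h A b y Z sigma (p := p)) R)
    (2 *: (R *m S)).
  split.
    apply/tangentE; rewrite -scalemxAr mulmxA scaler_nat mulr2n trace_opD.
    by rewrite -[R^T *m R]/(symmx_val (gram R)) Sk_stationary addr0.
  move=> W /tangentE RW0; rewrite gradM_Psi -scalerBr -mulmxBr innerZl inner_mull.
  rewrite /S /Sk symmx_valD symmx_valN subKr inner_trace_op_adj RW0.
  by rewrite -(scale0r 0) innerZr mul0r mulr0.
exact: is_proj_unique (xgetPex 0 (ex_intro _ _ proj)) proj.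
Qed.

End PulledBackGradient.

(** * The optimality gap from the gradient and curvature conditions *)

Theorem proposition3p3 (K : realType) (n m m0 p : nat)
  (A : 'I_m -> symmx K n) (B : 'I_m0 -> symmx K n)
  (b : 'rV[K]_m) (b0 : 'rV[K]_m0)
  (f : symmx K n -> K) (h : symmx K n -> \bar K)
  (y : 'rV[K]_m) (Z : symmx K n) (sigma : K)
  (p_gt0 : (0 < p)%N) (sigma_gt0 : 0 < sigma)
  (opt_ex : exists X, optimal B b0 f h A b X)
  (obj_bounded : exists c : K, forall X, feasible B b0 A b X ->
     (c%:E <= objective f h X)%E)
  (f_convex : convex_function [set: convex_lmodType (symmx K n)] f)
  (f_diff : forall X, differentiable f X)
  (f_diff2 : forall X, differentiable (gradS f) X)
  (f_lip : exists L : K, forall X X' : symmx K n,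
     frob_norm (gradS f X - gradS f X') <= L * frob_norm (X - X'))
  (h_convex : econvex h) (h_lsc : lower_semicontinuous h) (h_proper : eproper h)
  (licq : forall X : symmx K n, Dset B b0 X -> free [tuple B i *m X | i < m0])
  (M_compact : compact (Mset B b0 p))
  (M_submanifold : embedded_submanifold (Mset B b0 p))
  (Xstar : symmx K n) (Xstar_D : Dset B b0 Xstar)
  (Xstar_min : forall X, Dset B b0 X ->
     Phi f h A b y Z sigma Xstar <= Phi f h A b y Z sigma X)
  (Xstar_rank : (\rank Xstar <= p)%N)
  (diamD : K)
  (diamD_max : is_max [set \tr X | X in Dset B b0] diamD)
  (eps_g eps_H : K) (eps_g_ge0 : 0 <= eps_g) (eps_H_ge0 : 0 <= eps_H)
  (R : 'M[K]_(p, n)) (R_M : Mset B b0 p R)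
  (R_grad : frob_norm (rgradPsi B f h A b y Z sigma R) <= eps_g)
  (R_curv : psd ((Sk B f h A b y Z sigma (gram R) : 'M[K]_n) + eps_H *: 1%:M)) :
  exists2 minPsi : K,
    is_min [set Psi f h A b y Z sigma R' | R' in Mset B b0 p] minPsi &
    Psi f h A b y Z sigma R - minPsi
      <= Num.sqrt diamD * (eps_g / 2) + diamD * eps_H
    /\ ((1%:M : 'M[K]_n) \in <<[tuple (B i : 'M[K]_n) | i < m0]>>%VS ->
        Psi f h A b y Z sigma R - minPsi <= diamD * eps_H).
Proof.
set Phi' := Phi f h A b y Z sigma.
have [Phi_diff Phi_grad Phi_cvx] := Phi_first_order A b y Z sigma_gt0
  h_convex h_lsc h_proper f_convex f_diff (gram R).
have XD := Dset_gram R_M; have licqR := licq _ XD.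
set S := Sk B f h A b y Z sigma (gram R) in R_curv.
have S0 : trace_op B (gram R *m S) = 0 by exact: Sk_stationary.
have rgradE : rgradPsi B f h A b y Z sigma R = 2 *: (R *m S) by exact: rgradPsiE.
have [u gradE] : exists u, gradS Phi' (gram R) = S + trace_op_adj B u.
  by exists (uk B f h A b y Z sigma (gram R)); rewrite subrK.
clearbody S.
have [Rs RsX] := psd_gram (symmx_tr Xstar) Xstar_D.1 Xstar_rank.
have {}RsX : gram Rs = Xstar by exact: val_inj.
(* In the tangent inequality the multiplier terms cancel, since [gram R] and [Xstar] have the same
   image under [trace_op B]. *)
have gap : Psi f h A b y Z sigma R - Phi' Xstar <= inner S (gram R) - inner S Xstar.
  have := Phi_cvx Xstar; rewrite -/Phi' gradE symmx_valD (symmx_valD Xstar).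
  rewrite symmx_valN innerDr innerNr !innerDl !inner_trace_op_adj.
  rewrite XD.2 Xstar_D.2 /Psi -/Phi'.
  by move: (Phi' _) (Phi' _) (inner S _) (inner S _) (inner u _); clear; move=> *; lra.
(* Pair the semidefinite matrix [S + eps_H I] with [Xstar = gram Rs], whose trace is at most
   [diamD]. *)
have curv : - inner S Xstar <= diamD * eps_H.
  have := psd_inner_gram Rs R_curv; rewrite RsX innerDl innerZl.
  have -> : inner (1%:M : 'M[K]_n) Xstar = \tr (Xstar : 'M[K]_n).
    by rewrite /inner trmx1 mul1mx.
  have : \tr (Xstar : 'M[K]_n) <= diamD by apply: diamD_max.2; exists Xstar.
  move=> /(ler_wpM2l eps_H_ge0); lra.
have trX : \tr (gram R : 'M[K]_n) <= diamD by apply: diamD_max.2; exists (gram R).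
exists (Phi' Xstar).
  split; last by move=> _ [R' MR' <-]; apply: Xstar_min; exact: Dset_gram.
  exists Rs; last by rewrite /Psi RsX.
  by have := Xstar_D.2; rewrite -RsX.
split=> [|I_span].
  (* The left side pairs the Riemannian gradient [2 *: (R *m S)] with [R]; apply Cauchy-Schwarz, the
     squared norm of [R] being the trace of [gram R]. *)
  have : 2 * inner S (gram R) <= eps_g * Num.sqrt diamD.
    rewrite -inner_mull -innerZl -rgradE (le_trans (inner_le_frob _ _)) //.
    by rewrite ler_pM ?frob_norm_ge0 // ler_wsqrtr.
  lra.
(* Expanding the identity in the [B i] writes this inner product as a combination of the entries of
   [trace_op B (gram R *m S)], all zero. *)
have SX0 : inner S (gram R) = 0.
  rewrite inner_symmx mxtrace_mulC -[X in \tr X]mul1mx (coord_span I_span).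
  rewrite mulmx_suml raddf_sum big1 // => i _.
  rewrite -scalemxAl -tnth_nth tnth_mktuple /= mxtraceZ.
  by move/rowP/(_ i): S0; rewrite !mxE => ->; rewrite mulr0.
by move: gap; rewrite SX0; lra.
Qed.
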